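(* Let $\Omega=\bigcup_{m=1}^M\Omega_m$ be partitioned into $M$ non-overlapping subdomains, and fix a coordinate index $k$. For each $m$ let $\mathcal{D}_{x_k,m}=\mathcal{P}_m^{-1}\mathcal{Q}_{x_k,m}$ be a summation-by-parts operator on $\Omega_m$ with $$\mathcal{Q}_{x_k,m}+\mathcal{Q}_{x_k,m}^\top=(E_m^e)^\top P_m^eN_{x_k,m}^eE_m^e+(E_m^i)^\top P_m^iN_{x_k,m}^iE_m^i ,$$ where superscripts $e$ and $i$ refer to exterior boundary nodes and interior interface nodes of $\Omega_m$. Define the global matrices $$\mathcal{P}=\sum_{m}(\tilde I_m^v)^\top\mathcal{P}_m\tilde I_m^v,\qquad \bar{\mathcal{Q}}_{x_k}=\sum_{m}(\tilde I_m^v)^\top\mathcal{Q}_{x_k,m}\tilde I_m^v,$$ $$P^s=\sum_m(\tilde I_m^s)^\top P_m^s\tilde I_m^s,\quad N_{x_k}^s=\sum_m(\tilde I_m^s)^\top N_{x_k,m}^s\tilde I_m^s,\quad E^s=\sum_m(\tilde I_m^s)^\top E_m^s\tilde I_m^v\qquad (s\in\{e,i\}),$$ and $$N_{x_k}^*=\sum_{m=1}^M\sum_{n\in\mathcal{N}_m}\tfrac12(\tilde I_m^i)^\top\big[N_{x_k,m}^iI_{nm}-I_{nm}N_{x_k,n}^i\big]\tilde I_n^i,\qquad \mathcal{Q}_{x_k}=\bar{\mathcal{Q}}_{x_k}-\tfrac12(E^i)^\top P^i\big(N_{x_k}^i-N_{x_k}^*\big)E^i .$$ Suppose that the interface operators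 satisfy the pairwise inner product preserving condition $$P_n^iI_{mn}=(P_m^iI_{nm})^\top\qquad\text{for all } m \text{ and all } n\in\mathcal{N}_m .$$ Then the global operator $\mathcal{D}_{x_k}=\mathcal{P}^{-1}\mathcal{Q}_{x_k}$ satisfies the summation-by-parts property on the full nodal mesh on $\Omega$: $$\mathcal{Q}_{x_k}+\mathcal{Q}_{x_k}^\top=(E^e)^\top P^eN_{x_k}^eE^e .$$
   Context: All matrices are real. The boundary of each subdomain is split as $\partial\Omega_m=\partial^e\Omega_m\cup\partial^i\Omega_m$, where $\partial^e\Omega_m$ lies on the exterior boundary of $\Omega$ (possibly empty) and $\partial^i\Omega_m$ consists of internal interfaces with neighbouring subdomains. On $\Omega_m$ there are finite sets of volume nodes, exterior boundary nodes (on $\partial^e\Omega_m$) and interface nodes (on $\partial^i\Omega_m$). $\mathcal{P}_m>0$, $P_m^e>0$, $P_m^i>0$ are diagonal matrices of quadrature weights on the volume, exterior boundary and interface nodes of $\Omega_m$; $N_{x_k,m}^e,N_{x_k,m}^i$ are diagonal matrices of (exact or approximate) values of the $k$-th component of the outward unit normal; $E_m^e,E_m^i$ are (rectangular) projection matrices from the volume nodes to the exterior boundary, respectively interface, nodes of $\Omega_m$. For $s\in\{v,e,i\}$, $\tilde I_m^s=(0\ \cdots\ 0\ I_m^s\ 0\ \cdots\ 0)$ is the block restriction operator from the collection over all subdomains of volume ($v$), exterior boundary ($e$) or interface ($i$) nodes to those belonging to $\Omega_m$, $I_m^s$ being the identity of the corresponding size in block position $m$. $\mathcal{N}_m$ is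 the set of indices $n\neq m$ of the subdomains adjacent to $\Omega_m$ with at least partially overlapping faces, i.e. such that $\partial^i\Omega_n\cap\partial^i\Omega_m$ has nonzero surface measure (so $n\in\mathcal{N}_m$ iff $m\in\mathcal{N}_n$). For $n\in\mathcal{N}_m$, $I_{nm}$ is a discrete projection or interpolation matrix mapping values at the interface nodes of $\Omega_n$ to values at the interface nodes of $\Omega_m$. *)

(* Defs.v *)
From mathcomp Require Import all_boot all_order all_algebra.
From mathcomp Require Import all_classical all_reals all_analysis.

Set Implicit Arguments.
Unset Strict Implicit.
Unset Printing Implicit Defensive.

Import Order.TTheory GRing.Theory Num.Theory.
Import numFieldNormedType.Exports.
Local Open Scope classical_set_scope.
Local Open Scope ring_scope.

Section SurfaceMeasure.
Variables (R : realType) (d : nat).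
Implicit Types (A B : set 'rV[R]_d) (s : nat).

(* The library norm on row vectors is the sup norm, hence the explicit
   Euclidean distance. *)
Definition euclidean_dist (x y : 'rV[R]_d) : R :=
  Num.sqrt (\sum_(i < d) (x ord0 i - y ord0 i) ^+ 2).

(* [-oo] on the empty set *)
Definition diam A : \bar R :=
  ereal_sup [set (euclidean_dist x y)%:E | x in A & y in A].

(* The empty set must count 0 also when [s = 0], so that [hausdorff 0] is the
   counting measure. *)
Definition diam_weight s A : \bar R :=
  if `[< A = set0 >] then 0%E else (diam A ^+ s)%E.

Definition hausdorff_pre s (delta : R) A : \bar R :=
  ereal_inf [set (\sum_(0 <= i <oo) diam_weight s (C i))%E |
    C in [set C : nat -> set 'rV[R]_d |
           A `<=` \bigcup_i C i /\ (forall i, (diam (C i) <= delta%:E)%E)]].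

Definition hausdorff s A : \bar R :=
  ereal_sup [set hausdorff_pre s delta A | delta in [set e : R | 0 < e]].

(* The (d-1)-dimensional Hausdorff measure; the usual dimensional constant is
   omitted since only null sets matter below. *)
Definition surface_measure A : \bar R := hausdorff d.-1 A.

Definition bdry A : set 'rV[R]_d := closure A `\` interior A.

End SurfaceMeasure.

Record partitioned_domain (R : realType) (d M : nat) := PartitionedDomain {
  subdomain : 'I_M -> set 'rV[R]_d;
  ext_bdry : 'I_M -> set 'rV[R]_d;
  int_bdry : 'I_M -> set 'rV[R]_d;
  subdomain_nonoverlap : forall m n, m != n ->
    interior (subdomain m) `&` interior (subdomain n) = set0;
  bdry_split : forall m, bdry (subdomain m) = ext_bdry m `|` int_bdry m;
  ext_bdry_sub : forall m,
    ext_bdry m `<=` bdry (\bigcup_(n in [set: 'I_M]) subdomain n);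
  int_bdry_sub : forall m,
    int_bdry m `<=` \bigcup_(n in [set n | n != m]) bdry (subdomain n)
}.

Definition neighbours (R : realType) (d M : nat)
    (Omega : partitioned_domain R d M) (m : 'I_M) : {set 'I_M} :=
  [set n | (n != m) &&
    (surface_measure (int_bdry Omega n `&` int_bdry Omega m) != 0%E)]%SET.

Lemma neighbours_sym (R : realType) (d M : nat)
    (Omega : partitioned_domain R d M) (m n : 'I_M) :
  (n \in neighbours Omega m) = (m \in neighbours Omega n).
Proof. by rewrite !finset.inE eq_sym setIC. Qed.

Definition posdiag (R : realType) (n : nat) (A : 'M[R]_n) : Prop :=
  is_diag_mx A /\ forall i, 0 < A i i.

Lemma posdiag_unitmx (R : realType) (n : nat) (A : 'M[R]_n) :
  posdiag A -> A \in unitmx.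
Proof.
move=> [/is_diag_mxP dA pA]; rewrite unitmxE.
have -> : A = diag_mx (\row_i A i i).
  apply/matrixP => i j; rewrite !mxE; have [->|ij] := eqVneq i j.
    by rewrite mulr1n.
  by rewrite mulr0n dA.
rewrite det_diag unitfE; apply/prodf_neq0 => i _.
by rewrite mxE gt_eqF.
Qed.

(* [B] is the boundary matrix E^T P N E, respectively a sum of such terms. *)
Definition is_sbp (R : realType) (n : nat) (D P Q B : 'M[R]_n) : Prop :=
  [/\ posdiag P, D = invmx P *m Q & Q + Q^T = B].

Section Assembly.
Variables (R : realType) (M : nat).

(* [pid_mx (p m)] is the identity in block position [m] (see [restrictK]), but
   has type ['M_(p m, p j)] for every [j]. *)
Definition restrict (p : 'I_M -> nat) (m : 'I_M) :
    'M[R]_(p m, \sum_(j < M) p j) :=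
  \mxrow_(j < M) (if j == m then pid_mx (p m) else 0).

Lemma restrictK p m : submxrow (restrict p m) m = 1%:M.
Proof. by rewrite mxrowK eqxx pid_mx_1. Qed.

Lemma restrict0 p m j : j != m -> submxrow (restrict p m) j = 0.
Proof. by move=> /negPf jm; rewrite mxrowK jm. Qed.

Definition assemble (p q : 'I_M -> nat) (A : forall m, 'M[R]_(p m, q m)) :
    'M[R]_(\sum_(m < M) p m, \sum_(m < M) q m) :=
  \sum_(m < M) (restrict p m)^T *m A m *m restrict q m.

(* [itf n m] is the operator I_{nm}, mapping values at the interface nodes of
   subdomain [n] to values at those of subdomain [m]. *)
Definition interface_normals (d : nat) (Omega : partitioned_domain R d M)
    (ni : 'I_M -> nat) (Ni : forall m, 'M[R]_(ni m))
    (itf : forall n m, 'M[R]_(ni m, ni n)) :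
    'M[R]_(\sum_(m < M) ni m) :=
  \sum_(m < M) \sum_(n in neighbours Omega m)
    2^-1 *: ((restrict ni m)^T *m (Ni m *m itf n m - itf n m *m Ni n)
             *m restrict ni n).

Definition global_Q (d : nat) (Omega : partitioned_domain R d M)
    (nv ni : 'I_M -> nat) (Q : forall m, 'M[R]_(nv m))
    (Pi Ni : forall m, 'M[R]_(ni m)) (Ei : forall m, 'M[R]_(ni m, nv m))
    (itf : forall n m, 'M[R]_(ni m, ni n)) :
    'M[R]_(\sum_(m < M) nv m) :=
  assemble Q - 2^-1 *: ((assemble Ei)^T *m assemble Pi
    *m (assemble Ni - interface_normals Omega Ni itf) *m assemble Ei).

End Assembly.

(* Main.v *)
Require Import Defs.
From mathcomp Require Import all_boot all_order all_algebra.
From mathcomp Require Import all_classical all_reals all_analysis.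
Import GRing.Theory.
Local Open Scope ring_scope.

(** Since the restriction operators satisfy [I_m I_n^T = delta_mn], [assemble]
    turns blockwise products, sums and transposes into global ones
    ([mulmx_assemble], [assembleD], [tr_assemble]). Summing the local
    summation-by-parts identities therefore gives

      [Qbar + Qbar^T = (E^e)^T P^e N^e E^e + X],  [X = (E^i)^T P^i N^i E^i].

    The correction in [global_Q] subtracts [(X - Y) / 2], where
    [Y = (E^i)^T P^i N^* E^i]. The matrix [X] is symmetric, being a congruence of
    a product of diagonal matrices. The matrix [Y] is antisymmetric
    ([tr_mul_interface_normals]): diagonal matrices commute, so by the inner
    product preserving condition the [(m, n)] term of [P^i N^*] is minus the
    transpose of its [(n, m)] term. The symmetric part of the correction thus
    removes exactly [X], and [Y] contributes nothing. *)

Section DiagonalMatrices.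
Variables (K : comPzSemiRingType) (n : nat).
Implicit Types A B : 'M[K]_n.

Lemma tr_is_diag_mx A : is_diag_mx A -> A^T = A.
Proof. by move=> /diag_mxP [a ->]; rewrite tr_diag_mx. Qed.

Lemma is_diag_mxC A B : is_diag_mx A -> is_diag_mx B -> A *m B = B *m A.
Proof. by move=> /diag_mxP [a ->] /diag_mxP [b ->]; rewrite diag_mxC. Qed.

End DiagonalMatrices.

Section Assembly.
Variables (R : realType) (M : nat).
Implicit Types p q r : 'I_M -> nat.

Lemma restrict_mul_tr p m :
  Defs.restrict R p m *m (Defs.restrict R p m)^T = 1%:M.
Proof.
rewrite /Defs.restrict tr_mxrow mul_mxrow_mxcol [LHS](bigD1 m) //= eqxx.
rewrite pid_mx_1 mul1mx trmx1 [X in _ + X]big1 ?addr0 // => j /negPf ->.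
by rewrite mul0mx.
Qed.

Lemma restrict_mul_tr0 p m n :
  m != n -> Defs.restrict R p m *m (Defs.restrict R p n)^T = 0.
Proof.
move=> mn; rewrite /Defs.restrict tr_mxrow mul_mxrow_mxcol big1 // => j _.
have [->|_] := eqVneq j m; last by rewrite mul0mx.
by rewrite (negPf mn) trmx0 mulmx0.
Qed.

(** Orthogonality of the restrictions leaves one term of the sum. In this
    one-sided form it applies also to products with [interface_normals], which
    is a sum of off-diagonal blocks. *)
Lemma assemble_mul_tr_restrict p q (A : forall m, 'M[R]_(p m, q m)) m :
  assemble A *m (Defs.restrict R q m)^T = (Defs.restrict R p m)^T *m A m.
Proof.
rewrite /assemble mulmx_suml [LHS](bigD1 m) //= -mulmxA restrict_mul_tr mulmx1.
rewrite [X in _ + X]big1 ?addr0 // => j jm.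
by rewrite -mulmxA restrict_mul_tr0 // mulmx0.
Qed.

Lemma mulmx_assemble p q r (A : forall m, 'M[R]_(p m, q m))
    (B : forall m, 'M[R]_(q m, r m)) :
  assemble A *m assemble B = assemble (fun m => A m *m B m).
Proof.
rewrite [assemble B]/assemble mulmx_sumr; apply: eq_bigr => m _.
by rewrite !mulmxA assemble_mul_tr_restrict.
Qed.

Lemma tr_assemble p q (A : forall m, 'M[R]_(p m, q m)) :
  (assemble A)^T = assemble (fun m => (A m)^T).
Proof.
rewrite /assemble raddf_sum; apply: eq_bigr => m _ /=.
by rewrite !trmx_mul trmxK mulmxA.
Qed.

Lemma assembleD p q (A B : forall m, 'M[R]_(p m, q m)) :
  assemble A + assemble B = assemble (fun m => A m + B m).
Proof.
by rewrite /assemble -big_split; apply: eq_bigr => m _; rewrite mulmxDr mulmxDl.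
Qed.

Lemma eq_assemble p q (A B : forall m, 'M[R]_(p m, q m)) :
  (forall m, A m = B m) -> assemble A = assemble B.
Proof. by move=> AB; apply: eq_bigr => m _; rewrite AB. Qed.

(** Gives access to individual entries, which the definition of [assemble] as a
    sum of products hides. *)
Lemma assemble_mxdiag p (A : forall m, 'M[R]_(p m)) :
  assemble A = \mxdiag_m A m.
Proof.
rewrite /assemble /Defs.restrict.
under [LHS]eq_bigr do rewrite tr_mxrow mxcol_mul mul_mxcol_mxrow.
rewrite -mxblock_sum; apply: eq_mxblock => i j.
have [<-|ij] := eqVneq i j.
  rewrite [LHS](bigD1 i) //= eqxx pid_mx_1 trmx1 mul1mx mulmx1.
  rewrite [X in _ + X]big1 ?addr0; last first.
    by move=> k ki; rewrite eq_sym (negPf ki) mulmx0.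
  by rewrite conform_mx_id.
rewrite big1 // => k _; have [ik|_] := eqVneq i k; last by rewrite trmx0 !mul0mx.
by rewrite -ik eq_sym (negPf ij) mulmx0.
Qed.

Lemma posdiag_assemble p (A : forall m, 'M[R]_(p m)) :
  (forall m, posdiag (A m)) -> posdiag (assemble A).
Proof.
move=> hA; rewrite assemble_mxdiag; split.
  apply/is_diag_mxblockP; split=> [i j /negPf -> //|i].
  by rewrite eqxx conform_mx_id; have [] := hA i.
by move=> i; rewrite mxE eqxx conform_mx_id; have [_] := hA (tagnat.sig1 i).
Qed.

(** Pairs each [(m, n)] term with the [(n, m)] term, which is legitimate because
    adjacency is symmetric. Writing [J_nm] for [itf n m], moving the diagonal
    [Pi m] past [Ni m] and the inner product preserving condition give
    [(Pi_m Ni_m J_nm)^T = (Ni_m Pi_m J_nm)^T = Pi_n J_mn Ni_m], so that transposing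
    swaps the two terms of [C m n] with those of [C n m], up to sign. *)
Lemma tr_mul_interface_normals d (Omega : partitioned_domain R d M) ni
    (Pi Ni : forall m, 'M[R]_(ni m)) (itf : forall n m, 'M[R]_(ni m, ni n)) :
  (forall m, is_diag_mx (Pi m)) -> (forall m, is_diag_mx (Ni m)) ->
  (forall m n, n \in neighbours Omega m ->
     Pi n *m itf m n = (Pi m *m itf n m)^T) ->
  (assemble Pi *m interface_normals Omega Ni itf)^T
  = - (assemble Pi *m interface_normals Omega Ni itf).
Proof.
move=> dP dN hitf.
pose C m n := Pi m *m (Ni m *m itf n m - itf n m *m Ni n).
have trC m n : n \in neighbours Omega m -> (C m n)^T = - C n m.
  move=> mn; rewrite /C !mulmxBr opprB raddfB /=.
  have -> : Pi m *m (Ni m *m itf n m) = Ni m *m (Pi m *m itf n m).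
    by rewrite !mulmxA (is_diag_mxC _ _ (Pi m)).
  have -> : Pi n *m (Ni n *m itf m n) = Ni n *m (Pi n *m itf m n).
    by rewrite !mulmxA (is_diag_mxC _ _ (Pi n)).
  rewrite (mulmxA (Pi m)) (mulmxA (Pi n)) (hitf m n) //.
  by rewrite (trmx_mul (Ni m)) (trmx_mul _ (Ni n)) !(tr_is_diag_mx _ _ (Ni _)).
have -> : assemble Pi *m interface_normals Omega Ni itf =
    \sum_m \sum_(n in neighbours Omega m)
      2^-1 *: ((Defs.restrict R ni m)^T *m C m n *m Defs.restrict R ni n).
  rewrite mulmx_sumr; apply: eq_bigr => m _.
  rewrite mulmx_sumr; apply: eq_bigr => n _.
  by rewrite -scalemxAr !mulmxA assemble_mul_tr_restrict.
rewrite raddf_sum /= (eq_bigr _ (fun m _ => raddf_sum _ _ _ _)) /=.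
rewrite (exchange_big_dep predT) //= -sumrN; apply: eq_bigr => n _.
rewrite -sumrN; apply: eq_big => [m|m mn]; first by rewrite neighbours_sym.
rewrite linearZ /= 2!trmx_mul trmxK mulmxA trC //.
by rewrite mulmxN mulNmx scalerN.
Qed.

End Assembly.

Theorem proposition4 (R : realType) (d M : nat)
  (Omega : partitioned_domain R d M) (k : 'I_d)
  (nv ne ni : 'I_M -> nat)
  (P : forall m : 'I_M, 'M[R]_(nv m))
  (Pe : forall m : 'I_M, 'M[R]_(ne m))
  (Pi : forall m : 'I_M, 'M[R]_(ni m))
  (D Q : 'I_d -> forall m : 'I_M, 'M[R]_(nv m))
  (Ne : 'I_d -> forall m : 'I_M, 'M[R]_(ne m))
  (Ni : 'I_d -> forall m : 'I_M, 'M[R]_(ni m))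
  (Ee : forall m : 'I_M, 'M[R]_(ne m, nv m))
  (Ei : forall m : 'I_M, 'M[R]_(ni m, nv m))
  (itf : forall n m : 'I_M, 'M[R]_(ni m, ni n))
  (hPe : forall m, posdiag (Pe m))
  (hPi : forall m, posdiag (Pi m))
  (hNe : forall m, is_diag_mx (Ne k m))
  (hNi : forall m, is_diag_mx (Ni k m))
  (hsbp : forall m, is_sbp (D k m) (P m) (Q k m)
     ((Ee m)^T *m Pe m *m Ne k m *m Ee m + (Ei m)^T *m Pi m *m Ni k m *m Ei m))
  (hitf : forall m n : 'I_M, n \in neighbours Omega m ->
     Pi n *m itf m n = (Pi m *m itf n m)^T) :
  let Qk := global_Q Omega (Q k) Pi (Ni k) Ei itf in
  is_sbp (invmx (assemble P) *m Qk) (assemble P) Qk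
    ((assemble Ee)^T *m assemble Pe *m assemble (Ne k) *m assemble Ee).
Proof.
have dPi m : is_diag_mx (Pi m) by have [] := hPi m.
set X := (assemble Ei)^T *m assemble Pi *m assemble (Ni k) *m assemble Ei.
move=> Qk; set B := (X in is_sbp _ _ _ X).
pose Y := (assemble Ei)^T *m (assemble Pi *m interface_normals Omega (Ni k) itf)
  *m assemble Ei.
have trX : X^T = X.
  rewrite /X !tr_assemble !mulmx_assemble tr_assemble; apply: eq_assemble => m.
  rewrite !trmx_mul trmxK (tr_is_diag_mx _ _ (Ni k m)) //.
  rewrite (tr_is_diag_mx _ _ (Pi m)) // -(mulmxA _ (Pi m)).
  by rewrite (is_diag_mxC _ _ (Pi m)) // !mulmxA.
have trY : Y^T = - Y.
  rewrite /Y !trmx_mul trmxK -trmx_mul tr_mul_interface_normals //.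
  by rewrite mulNmx mulmxN mulmxA.
have QkE : Qk = assemble (Q k) - 2^-1 *: (X - Y).
  by rewrite /Qk /global_Q mulmxBr mulmxBl /X /Y !mulmxA.
have QbarE : assemble (Q k) + (assemble (Q k))^T = B + X.
  rewrite /B /X !tr_assemble !mulmx_assemble !assembleD; apply: eq_assemble => m.
  by have [_ _ ->] := hsbp m.
split=> //; first by apply: posdiag_assemble => m; have [] := hsbp m.
have trXY : (2^-1 *: (X - Y))^T = 2^-1 *: (X + Y).
  by rewrite [LHS]linearZ /= [(X - Y)^T]raddfB /= trX trY opprK.
rewrite QkE [(_ - _)^T]raddfB /= trXY addrACA QbarE -opprD -scalerDr.
have -> : X - Y + (X + Y) = X *+ 2 by rewrite [LHS]addrACA addNr addr0.
by rewrite -(scaler_nat 2 X) scalerA mulVf ?Num.Theory.pnatr_eq0 // scale1r addrK.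
Qed.
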